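(* Let $B = \{b_1 < b_2 < \dots\}$ be an infinite sequence of integers with $b_1 \geq 3$. If $b_2 = 3b_1 + 3$ or $b_2 = 3b_1 + 2$, then there is no sequence of positive integers $A = \{a_1 < a_2 < \dots\}$ such that $P(A) = \mathbb{N} \setminus B$.
   Context: $\mathbb{N}$ denotes the set of all nonnegative integers. For a set $A = \{a_1 < a_2 < \dots\}$ of positive integers, $P(A) = \{\sum \varepsilon_i a_i : a_i \in A, \varepsilon_i \in \{0,1\}, \sum \varepsilon_i < \infty\}$ is the set of all finite subset sums of $A$; in particular $0 \in P(A)$ (empty sum). *)

(* Defs.v *)
From mathcomp Require Export all_boot all_order finmap.
From mathcomp Require Export boolp classical_sets.

Set Implicit Arguments.
Unset Strict Implicit.
Unset Printing Implicit Defensive.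

(* P(A): a 0/1 choice of coefficients with finite support is a finite subset
   F of A. *)
Definition subset_sums (A : set nat) : set nat :=
  [set n | exists F : {fset nat},
     ([set` F] `<=` A)%classic /\ n = \sum_(x <- F) x]%classic.

(* Main.v *)
Require Import Defs.
From mathcomp Require Import all_boot all_order finmap.
From mathcomp Require Import boolp classical_sets.
From mathcomp Require Import zify.

(** Write [B = b 0]. Since [0, ..., B - 1] are subset sums and [B] is not, the
    sums of elements of [A] below [B] are exactly [0, ..., B - 1]; then [B + 1]
    must lie in [A]. Any [c] in [A] with [B + 1 < c < b 1 - B] and
    [b 1 <= c + 2 B] would make [b 1 = c + (B + 1) + r] with [r < B] a subset
    sum. Without such a [c], however, the first number left uncovered by the
    remaining small elements ([2 B + 1] if [b 1 = 3 B + 2], and [2 B + 2] if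
    [b 1 = 3 B + 3]) is not a subset sum, although it is smaller than [b 1]. *)

(** The strict cutoff [m] allows induction that decides one candidate element of [A] at a time. *)
Definition subset_sums_below (A : set nat) (m n : nat) : Prop :=
  exists F : {fset nat},
    (forall x, x \in F -> A x /\ x < m) /\ n = \sum_(x <- F) x.

Section SubsetSumsBelow.

Set Implicit Arguments.
Unset Strict Implicit.

Variable A : set nat.

Lemma subset_sums_below_le m m' n :
  m <= m' -> subset_sums_below A m n -> subset_sums_below A m' n.
Proof.
move=> le_mm' [F [FA ->]]; exists F; split=> // x /FA[Ax lt_xm].
by split=> //; apply: leq_trans le_mm'.
Qed.

Lemma subset_sums_below_subset_sums m n :
  subset_sums_below A m n -> subset_sums A n.
Proof. by move=> [F [FA ->]]; exists F; split=> // x /FA[]. Qed.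

Lemma subset_sums_subset_sums_below n :
  subset_sums A n -> subset_sums_below A n.+1 n.
Proof.
move=> [F [FA ->]]; exists F; split=> // x xF; split; first exact: FA.
by rewrite ltnS (big_fsetD1 x xF) leq_addr.
Qed.

(** A subset either omits [m] or splits off one copy of it; [m <= n] guards against the truncated
    subtraction. *)
Lemma subset_sums_belowS m n :
  subset_sums_below A m.+1 n <->
  subset_sums_below A m n \/
  A m /\ m <= n /\ subset_sums_below A m (n - m).
Proof.
split=> [[F [FA ->]]|[|[Am [le_mn [F [FA sumF]]]]]]; last 2 first.
- exact: subset_sums_below_le.
- have mNF : m \notin F by apply/negP=> /FA[_]; rewrite ltnn.
  exists (m |` F)%fset; split=> [x|]; last first.
    by rewrite big_fsetU1 //= -sumF subnKC.
  by rewrite in_fset1U => /orP[/eqP->//|/FA[Ax /ltnW]].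
have [mF|mNF] := boolP (m \in F); last first.
  left; exists F; split=> // x xF; have [Ax] := FA _ xF.
  rewrite ltnS leq_eqVlt => /orP[/eqP xm|//].
  by rewrite -xm xF in mNF.
right; have [Am _] := FA _ mF; split=> //; split.
  by rewrite (big_fsetD1 m mF) leq_addr.
exists (F `\ m)%fset; split=> [x|]; last by rewrite (big_fsetD1 m mF) addKn.
rewrite in_fsetD1 => /andP[x_neq_m /FA[Ax]].
by rewrite ltnS leq_eqVlt (negbTE x_neq_m).
Qed.

Lemma subset_sums_below_gap m m' n :
  (forall x, m <= x < m' -> ~ A x) ->
  subset_sums_below A m' n -> subset_sums_below A m n.
Proof.
move=> gap [F [FA ->]]; exists F; split=> // x /FA[Ax lt_xm']; split=> //.
by rewrite ltnNge; apply/negP=> le_mx; apply: (gap x) => //; rewrite le_mx.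
Qed.

(** Induction on [m]: every number below [m] is a sum of elements below [m], so [m <= s.+1]. If [m]
    is in [A], the shifted copy [[m, s + m]] therefore meets or adjoins [[0, s]] and leaves no
    hole. *)
Lemma subset_sums_below_interval m :
  (forall n, n < m -> subset_sums A n) ->
  exists s, forall n, subset_sums_below A m n <-> n <= s.
Proof.
elim: m => [_|m IHm small].
  exists 0 => n; rewrite leqn0; split=> [[F [FA ->]]|/eqP->].
    by rewrite big_seq big1 // => x /FA[].
  by exists fset0; split; [move=> x; rewrite inE | rewrite big_seq_fset0].
have [|s sP] := IHm; first by move=> n /ltnW /small.
have below_m n : n < m -> n <= s.
  move=> lt_nm; apply/sP; apply: subset_sums_below_le (lt_nm) _.
  by apply/subset_sums_subset_sums_below/small/ltnW.
have [Am|NAm] := pselect (A m); [exists (s + m) | exists s] => n;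
  rewrite subset_sums_belowS !sP; last by split=> [[|[]]|] //; left.
split=> [[|[_ []]]|le_n]; [lia | lia |].
have [|lt_sn] := leqP n s; first by left.
right; split=> //; split; last lia.
by rewrite leqNgt; apply/negP=> /below_m; lia.
Qed.

(** The interval [[0, s]] must stop before the missing value [m], yet it contains everything
    smaller. *)
Lemma subset_sums_below_first_gap m :
  (forall n, n < m -> subset_sums A n) -> ~ subset_sums A m ->
  forall n, subset_sums_below A m n <-> n < m.
Proof.
move=> small Nm n; have [s sP] := subset_sums_below_interval small.
have lt_sm : s < m.
  rewrite ltnNge; apply/negP=> /sP.
  by move/subset_sums_below_subset_sums.
split=> [/sP le_ns|lt_nm]; first exact: leq_ltn_trans lt_sm.
apply: subset_sums_below_le (lt_nm) _.
exact/subset_sums_subset_sums_below/small.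
Qed.

End SubsetSumsBelow.

Theorem theorem1p2 (b : nat -> nat)
    (b_incr : forall i j : nat, i < j -> b i < b j)
    (b1_ge3 : 3 <= b 0)
    (b2_eq : b 1 = 3 * b 0 + 3 \/ b 1 = 3 * b 0 + 2) :
  ~ exists A : set nat,
      (forall x : nat, A x -> 0 < x) /\
      subset_sums A = (~` range b)%classic.
Proof.
case=> A [_ sumsA].
have Nsum i : ~ subset_sums A (b i) by rewrite sumsA; apply; exists i.
have sum n : n < b 1 -> n <> b 0 -> subset_sums A n.
  move=> lt_nb1 n_neq_b0; rewrite sumsA => -[[|[|i]] _ def_n].
  - exact: n_neq_b0.
  - by rewrite def_n ltnn in lt_nb1.
  - by have := b_incr 1 i.+2 isT; rewrite def_n ltnNge ltnW.
move: (Nsum 0) (Nsum 1) sum b2_eq b1_ge3.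
move: (b 0) (b 1) => m q {b b_incr sumsA Nsum} Nm Nq sum q_eq m_ge3.
have belowm : forall n, subset_sums_below A m n <-> n < m.
  apply: subset_sums_below_first_gap Nm => n lt_nm; apply: sum; lia.
have belowSm n : subset_sums_below A m.+1 n <-> n < m.
  rewrite subset_sums_belowS belowm; split; last by left.
  case=> // -[Am _]; case: Nm.
  apply: (@subset_sums_below_subset_sums _ m.+1); apply/subset_sums_belowS.
  by right; split=> //; rewrite subnn belowm; lia.
have below_sum n : n < q -> n <> m -> subset_sums_below A n.+1 n.
  by move=> lt_nq n_neq_m; apply/subset_sums_subset_sums_below/sum.
(* Elements up to [m] only reach sums below [m], so a representation of [m.+1] has to use [m.+1]
   itself. *)
have ASm : A m.+1.
  have: subset_sums_below A m.+2 m.+1 by apply: below_sum; lia.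
  by rewrite subset_sums_belowS belowSm => -[|[//]]; lia.
(* The second block is the first one shifted by [m.+1]; [m] stays a hole between them. *)
have below2 n : subset_sums_below A m.+2 n <-> n < m \/ m < n <= m.*2.
  rewrite subset_sums_belowS !belowSm; split=> [[|[_ []]]|[lt_nm|lt_mn]].
  - by left.
  - by move=> *; right; lia.
  - by left.
  - by right; split=> //; lia.
have gap c : m.+1 < c -> c + m < q -> q <= c + m.*2 -> ~ A c.
  move=> lt_mc lt_cq le_qc Ac; case: Nq.
  apply: (@subset_sums_below_subset_sums _ c.+1); apply/subset_sums_belowS.
  right; split=> //; split; first lia.
  by apply: (@subset_sums_below_le _ m.+2) => //; apply/below2; lia.
case: q_eq => q_eq.
(* Here [gap] excludes [m + 3] to [2 m + 2] but not [m + 2]. Using [m + 2] to reach [2 m + 2] would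
   leave the remainder [m], exactly the hole in [below2]. *)
- have: subset_sums_below A m.+3 m.*2.+2.
    apply: (@subset_sums_below_gap _ _ m.*2.+3) => [x ?|]; first apply: gap; try lia.
    by apply: below_sum; lia.
  by rewrite subset_sums_belowS !below2 => -[|[_ []]]; lia.
(* Now [gap] already starts at [m + 2], so [2 m + 1] would have to come from [below2], which ends at
   [2 m]. *)
- have: subset_sums_below A m.+2 m.*2.+1; last by rewrite below2; lia.
  apply: (@subset_sums_below_gap _ _ m.*2.+2) => [x ?|]; first apply: gap; try lia.
  by apply: below_sum; lia.
Qed.
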